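(* Let $\alpha,\beta\in\mathbb{R}$ with $\alpha\neq 0$, and let $(G_1,g,J)$ be the connected, simply connected three-dimensional Lorentzian Lie group with product structure $J$ whose Lie algebra $\mathfrak{g}$ has a pseudo-orthonormal basis $\{e_1,e_2,e_3\}$ ($e_3$ timelike) with $[e_1,e_2]=\alpha e_1-\beta e_3$, $[e_1,e_3]=-\alpha e_1-\beta e_2$, $[e_2,e_3]=\beta e_1+\alpha e_2+\alpha e_3$. Let $c\in\mathbb{R}$. Then $(G_1,g,J)$ is a first kind algebraic Ricci soliton associated to the canonical connection $\nabla^0$ with constant $c$ if and only if $\alpha^2+c=0$, $\beta=0$, $\alpha\neq 0$. In particular, in that case $\mathrm{Ric}^0(e_1)=-\alpha^2e_1$, $\mathrm{Ric}^0(e_2)=-\alpha^2e_2$, $\mathrm{Ric}^0(e_3)=\alpha^2e_2$, and $De_1=0$, $De_2=0$, $De_3=\alpha^2e_2+\alpha^2e_3$.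
   Context: The left-invariant Lorentzian metric $g$ satisfies $g(e_1,e_1)=g(e_2,e_2)=1$, $g(e_3,e_3)=-1$, $g(e_i,e_j)=0$ for $i\ne j$. All tensors and connections are left-invariant and evaluated on $\mathfrak{g}$. $\nabla$ is the Levi-Civita connection of $g$. The product structure is $Je_1=e_1$, $Je_2=e_2$, $Je_3=-e_3$, and $(\nabla_XJ)Y=\nabla_X(JY)-J(\nabla_XY)$. The canonical connection is $\nabla^0_XY=\nabla_XY-\frac12(\nabla_XJ)(JY)$, with curvature $R^0(X,Y)Z=\nabla^0_X\nabla^0_YZ-\nabla^0_Y\nabla^0_XZ-\nabla^0_{[X,Y]}Z$. Its Ricci tensor is $\rho^0(X,Y)=-g(R^0(X,e_1)Y,e_1)-g(R^0(X,e_2)Y,e_2)+g(R^0(X,e_3)Y,e_3)$ and the Ricci operator $\mathrm{Ric}^0$ is defined by $\rho^0(X,Y)=g(\mathrm{Ric}^0(X),Y)$. First kind algebraic Ricci soliton associated to $\nabla^0$ with constant $c$ means: $\mathrm{Ric}^0=c\,\mathrm{Id}+D$ where $D$ is a derivation of $\mathfrak{g}$, i.e. a linear map with $D[X,Y]=[DX,Y]+[X,DY]$ for all $X,Y\in\mathfrak{g}$. *)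

(* Defs.v *)
From HB Require Import structures.
From mathcomp Require Import all_boot all_order all_algebra.
From mathcomp Require Import reals.

Set Implicit Arguments.
Unset Strict Implicit.
Unset Printing Implicit Defensive.

Import Order.TTheory GRing.Theory Num.Theory.
Local Open Scope ring_scope.

(* Left-invariant geometry of a Lie group, expressed on its Lie algebra L:
   left-invariant vector fields are the vectors of L, and a left-invariant
   connection is a bilinear map nabla : L -> L -> L, written nabla X Y for
   nabla_X Y.  The bracket and the Levi-Civita connection are linear in each
   argument through the {bilinear _ -> _ -> _} structure, the metric is a
   symmetric bilinear form {symmetric L}. *)

Section LeftInvariantGeometry.
Variables (R : realType) (L : vectType R).
Implicit Types (br nabla : {bilinear L -> L -> L}) (g : {symmetric L}).
Implicit Types (X Y Z : L).

Definition is_lie_bracket br : Prop :=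
  (forall X, br X X = 0) /\
  (forall X Y Z, br X (br Y Z) + br Y (br Z X) + br Z (br X Y) = 0).

Definition pseudo_orthonormal g (e1 e2 e3 : L) : Prop :=
  [/\ g e1 e1 = 1, g e2 e2 = 1 & g e3 e3 = -1] /\
  [/\ g e1 e2 = 0, g e1 e3 = 0 & g e2 e3 = 0].

(* Torsion-freeness and metric compatibility.  The term X (g (Y, Z)) of the
   latter vanishes, since g (Y, Z) is constant for left-invariant Y and Z. *)
Definition is_levi_civita br g nabla : Prop :=
  (forall X Y, nabla X Y - nabla Y X = br X Y) /\
  (forall X Y Z, g (nabla X Y) Z + g Y (nabla X Z) = 0).

Definition product_structure (J : 'End(L)) (e1 e2 e3 : L) : Prop :=
  [/\ J e1 = e1, J e2 = e2 & J e3 = - e3].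

Definition nablaJ nabla (J : 'End(L)) X Y : L :=
  nabla X (J Y) - J (nabla X Y).

Definition canonical_connection nabla (J : 'End(L)) X Y : L :=
  nabla X Y - 2^-1 *: nablaJ nabla J X (J Y).

Definition curvature br (D : L -> L -> L) X Y Z : L :=
  D X (D Y Z) - D Y (D X Z) - D (br X Y) Z.

Definition ricci_tensor br g (e1 e2 e3 : L) (D : L -> L -> L) X Y : R :=
  - g (curvature br D X e1 Y) e1
  - g (curvature br D X e2 Y) e2
  + g (curvature br D X e3 Y) e3.

Definition is_ricci_operator g (rho : L -> L -> R) (Ric : 'End(L)) : Prop :=
  forall X Y, rho X Y = g (Ric X) Y.

Definition is_derivation br (D : 'End(L)) : Prop :=
  forall X Y, D (br X Y) = br (D X) Y + br X (D Y).

Definition soliton_derivation br (Ric : 'End(L)) (c : R) (D : 'End(L)) : Prop :=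
  is_derivation br D /\ Ric = c *: \1%VF + D.

Definition first_kind_algebraic_ricci_soliton br (Ric : 'End(L)) (c : R) : Prop :=
  exists D : 'End(L), soliton_derivation br Ric c D.

End LeftInvariantGeometry.

(* Main.v *)
Require Import Defs.
From HB Require Import structures.
From mathcomp Require Import all_boot all_order all_algebra.
From mathcomp Require Import reals ring.

Set Implicit Arguments.
Unset Strict Implicit.
Unset Printing Implicit Defensive.

Import Order.TTheory GRing.Theory Num.Theory.
Local Open Scope ring_scope.

(* In coordinates, the canonical connection is nabla^0_X = omega(X) K, where
   omega(x,y,z) = alpha x - beta z / 2 and K is the quarter turn e1 -> -e2,
   e2 -> e1, e3 -> 0.  All the operators nabla^0_X thus commute, so that
   R^0(X,Y) = -omega([X,Y]) K and
   Ric^0(X) = -omega([X,e2]) e1 + omega([X,e1]) e2.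
   The derivation condition for Ric^0 - c Id on [e1,e2] contains
   alpha^2 beta = 0 and alpha (alpha^2 + c) = 0; conversely it holds when
   beta = 0 and c = -alpha^2. *)

(** * The Koszul formula for left-invariant fields *)

Section LeviCivita.
Context {R : realType} {L : vectType R} (br : {bilinear L -> L -> L}).
Context (g : {symmetric L}) (nabla : {bilinear L -> L -> L}).

Lemma symmetric_formC (X Y : L) : g X Y = g Y X.
Proof. by rewrite [LHS]hermC expr0 mul1r. Qed.

Lemma koszul (X Y Z : L) : is_levi_civita br g nabla ->
  g (nabla X Y) Z = 2^-1 * (g (br X Y) Z - g (br Y Z) X + g (br Z X) Y).
Proof.
move=> [tors metr].
(* Torsion-freeness splits the three brackets into six [nabla] terms; compatibility on the three
   cyclic permutations of [X], [Y], [Z] pairs them, leaving twice [g (nabla X Y) Z]. *)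
rewrite -!tors !linearBl /=.
have m1 := metr X Y Z; have m2 := metr Y Z X; have m3 := metr Z X Y.
move: m1 m2 m3.
rewrite (symmetric_formC Y) (symmetric_formC Z) (symmetric_formC X).
move=> /eqP; rewrite addr_eq0 => /eqP ->.
move=> /eqP; rewrite addr_eq0 => /eqP ->.
move=> /eqP; rewrite addr_eq0 => /eqP ->.
by field.
Qed.

End LeviCivita.

(** * Coordinates in a pseudo-orthonormal frame *)

Section Frame.
Context {R : realType} {L : vectType R} {e1 e2 e3 : L}.
Hypothesis he : basis_of fullv [:: e1; e2; e3].
Context {g : {symmetric L}}.
Hypothesis hg : pseudo_orthonormal g e1 e2 e3.

(* Locked so that rewriting with form_vec does not unfold it. *)
Definition vec : R -> R -> R -> L :=
  locked (fun x y z => x *: e1 + y *: e2 + z *: e3).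

Lemma vec_sum x y z : vec x y z = x *: e1 + y *: e2 + z *: e3.
Proof. by rewrite /vec -lock. Qed.

Lemma form_frame :
  (((g e1 e1 = 1) * (g e1 e2 = 0) * (g e1 e3 = 0)) *
   ((g e2 e1 = 0) * (g e2 e2 = 1) * (g e2 e3 = 0)) *
   ((g e3 e1 = 0) * (g e3 e2 = 0) * (g e3 e3 = -1)))%type.
Proof.
have [[g11 g22 g33] [g12 g13 g23]] := hg.
rewrite (symmetric_formC g e2 e1) (symmetric_formC g e3 e1).
by rewrite (symmetric_formC g e3 e2).
Qed.

Lemma form_vec x y z :
  ((g (vec x y z) e1 = x) * (g (vec x y z) e2 = y) *
   (g (vec x y z) e3 = - z))%type.
Proof.
by rewrite !vec_sum !linearDl !linearZl_LR /= !form_frame; do !split; ring.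
Qed.

Lemma vecE X : X = vec (g X e1) (g X e2) (- g X e3).
Proof.
(* Products with the frame recover the coefficients, so any expansion of [X] is the stated one. *)
suff [x [y [z ->]]] : exists x y z, X = vec x y z.
  by rewrite !form_vec opprK.
have := coord_basis he (memvf X).
rewrite !big_ord_recl big_ord0 addr0 /= addrA => XE.
by do 3 eexists; rewrite vec_sum; exact: XE.
Qed.

Lemma frame_ext X Y :
  g X e1 = g Y e1 -> g X e2 = g Y e2 -> g X e3 = g Y e3 -> X = Y.
Proof. by move=> E1 E2 E3; rewrite (vecE X) E1 E2 E3 -vecE. Qed.

Lemma formE X Y : g X Y = g X e1 * g Y e1 + g X e2 * g Y e2 - g X e3 * g Y e3.
Proof.
rewrite {1}(vecE Y) !vec_sum !linearDr !linearZr_LR /=.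
by ring.
Qed.

Context {alpha beta : R} {br : {bilinear L -> L -> L}}.
Hypothesis hbr : is_lie_bracket br.
Hypothesis h12 : br e1 e2 = alpha *: e1 - beta *: e3.
Hypothesis h13 : br e1 e3 = - (alpha *: e1) - beta *: e2.
Hypothesis h23 : br e2 e3 = beta *: e1 + alpha *: e2 + alpha *: e3.

Lemma bracketC X Y : br X Y = - br Y X.
Proof.
have [alt _] := hbr; have := alt (X + Y).
rewrite linearDl !linearDr /= !alt add0r addr0.
by move=> /eqP; rewrite addr_eq0 => /eqP.
Qed.

(* The third coordinate of X is - g X e3, whence the signs. *)
Lemma bracketE X Y :
  br X Y =
  vec (alpha * (g X e1 * g Y e2 - g X e2 * g Y e1)
         + alpha * (g X e1 * g Y e3 - g X e3 * g Y e1)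
         - beta * (g X e2 * g Y e3 - g X e3 * g Y e2))
      (beta * (g X e1 * g Y e3 - g X e3 * g Y e1)
         - alpha * (g X e2 * g Y e3 - g X e3 * g Y e2))
      (- alpha * (g X e2 * g Y e3 - g X e3 * g Y e2)
         - beta * (g X e1 * g Y e2 - g X e2 * g Y e1)).
Proof.
have [alt _] := hbr.
rewrite {1}(vecE X) {1}(vecE Y) 2!vec_sum.
rewrite !linearDl !linearDr !linearZl_LR !linearZr_LR /= !alt.
rewrite (bracketC e2 e1) (bracketC e3 e1) (bracketC e3 e2) h12 h13 h23.
by apply: frame_ext; rewrite form_vec !(linearDl, linearNl, linearZl_LR) /=
  ?linear0l !form_frame; ring.
Qed.

(** * The canonical connection and its curvature *)

Context {J : 'End(L)} {nabla : {bilinear L -> L -> L}}.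
Hypothesis hJ : product_structure J e1 e2 e3.
Hypothesis hnabla : is_levi_civita br g nabla.

Lemma product_structureE X : J X = vec (g X e1) (g X e2) (g X e3).
Proof.
have [J1 J2 J3] := hJ.
by rewrite {1}(vecE X) !vec_sum !linearD !linearZ /= J1 J2 J3 scalerN scaleNr opprK.
Qed.

Definition omega X : R := alpha * g X e1 + 2^-1 * beta * g X e3.

Definition turn X : L := vec (g X e2) (- g X e1) 0.

(** Since [J] is an involution, nabla^0_X is (nabla_X + J nabla_X J) / 2, the part of nabla_X
    commuting with [J]. It is also g-skew, hence kills [e3] and rotates the plane of [e1], [e2];
    [omega X] is the rate of that rotation. *)
Lemma canonical_connectionE X Y :
  canonical_connection nabla J X Y = omega X *: turn Y.
Proof.
have JJ : J (J Y) = Y.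
  by rewrite !product_structureE !form_vec -vecE.
rewrite /canonical_connection /nablaJ JJ [J (nabla _ _)]product_structureE.
rewrite [J Y]product_structureE /omega /turn.
apply: frame_ext;
  rewrite !(form_vec, linearDl, linearNl, linearZl_LR) /=.
(* The Koszul formula leaves products of brackets with [X], [Y] and [J Y], which the frame turns
   into polynomials in the coordinates. *)
all: rewrite !(koszul _ _ _ hnabla) ![g (br _ _) X]formE.
all: rewrite ![g (br _ _) (vec _ _ _)]formE ?[g (br _ _) Y]formE.
all: by rewrite !bracketE !form_vec !form_frame; field.
Qed.

Lemma curvatureE X Y Z :
  curvature br (canonical_connection nabla J) X Y Z =
  - (omega (br X Y) *: turn Z).
Proof.
have turnZ a U : turn (a *: U) = a *: turn U.
  by apply: frame_ext; rewrite /turn !(form_vec, linearZl_LR) /= !form_vec; ring.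
rewrite /curvature !canonical_connectionE !turnZ !scalerA.
by rewrite [omega Y * _]mulrC subrr sub0r.
Qed.

(** * The Ricci operator and the soliton equation *)

Context {Ric : 'End(L)}.
Hypothesis hRic : is_ricci_operator g
  (ricci_tensor br g e1 e2 e3 (canonical_connection nabla J)) Ric.

(** The image of [turn] is orthogonal to [e3], so the [e3] term of the trace vanishes; [turn e3 = 0]
    gives the zero third coordinate. *)
Lemma ricci_operatorE X :
  Ric X = vec (- omega (br X e2)) (omega (br X e1)) 0.
Proof.
apply: frame_ext; rewrite -hRic /ricci_tensor !curvatureE.
all: rewrite !linearNl /= !linearZl_LR /= !form_vec !form_frame; ring.
Qed.

Lemma ricci_frame :
  [/\ Ric e1 = vec (- (alpha ^+ 2 + 2^-1 * beta ^+ 2)) 0 0,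
      Ric e2 = vec 0 (- (alpha ^+ 2 + 2^-1 * beta ^+ 2)) 0
    & Ric e3 = vec (2^-1 * alpha * beta) (alpha ^+ 2) 0].
Proof.
by split; rewrite ricci_operatorE /omega !bracketE !form_vec !form_frame;
  congr vec; field.
Qed.

Lemma soliton_derivationE c D X :
  soliton_derivation br Ric c D -> D X = Ric X - c *: X.
Proof.
move=> [_ ->].
by rewrite add_lfunE scale_lfunE id_lfunE addrAC subrr add0r.
Qed.

Lemma soliton_conditions c D : alpha != 0 -> soliton_derivation br Ric c D ->
  alpha ^+ 2 + c = 0 /\ beta = 0.
Proof.
move=> a0 sD; have [der _] := sD; have [R1 R2 R3] := ricci_frame.
(* [e1] and [e2] are eigenvectors of [D] with a common eigenvalue l, so the right-hand side is 2 l
   [e1,e2], which has no [e2] component. *)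
have := der e1 e2; rewrite h12 linearB !linearZ /=.
rewrite !(soliton_derivationE _ sD) R1 R2 R3 !bracketE => E.
have gE X := congr1 (g^~ X) E.
have := gE e1; have := gE e2.
rewrite !(form_vec, linearDl, linearNl, linearZl_LR) /= ?form_vec !form_frame.
move=> /eqP; rewrite -subr_eq0 => /eqP E2.
move=> /eqP; rewrite -subr_eq0 => /eqP E1.
have b0 : alpha ^+ 2 * beta = 0 by rewrite -oppr0 -E2; field.
(* In the [e1] coordinate the [beta ^+ 2] terms coming from l and from [Ric e3] cancel. *)
have c0 : alpha * (alpha ^+ 2 + c) = 0 by rewrite -E1; field.
move/eqP: b0; rewrite mulf_eq0 sqrf_eq0 (negPf a0) => /eqP ->.
by move/eqP: c0; rewrite mulf_eq0 (negPf a0) => /eqP ->.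
Qed.

Lemma soliton_operatorE c X : alpha ^+ 2 + c = 0 -> beta = 0 ->
  Ric X - c *: X = vec 0 (- alpha ^+ 2 * g X e3) (- alpha ^+ 2 * g X e3).
Proof.
move=> /eqP; rewrite addrC addr_eq0 => /eqP -> b0.
rewrite ricci_operatorE /omega !bracketE b0.
by apply: frame_ext;
  rewrite !(form_vec, linearDl, linearNl, linearZl_LR) /= ?form_vec ?form_frame;
  field.
Qed.

(** Put u = e2 + e3. For X = (x,y,z), DX = alpha^2 z u and, as beta = 0, [X,u] = alpha (y - z) u.
    For Y = (x',y',z') both sides of the Leibniz rule then equal alpha^3 (y z' - z y') u. *)
Lemma soliton_exists c : alpha ^+ 2 + c = 0 -> beta = 0 ->
  first_kind_algebraic_ricci_soliton br Ric c.
Proof.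
move=> hc b0; exists (Ric - c *: \1%VF); split; last by rewrite addrC subrK.
have DE X : (Ric - c *: \1%VF) X =
    vec 0 (- alpha ^+ 2 * g X e3) (- alpha ^+ 2 * g X e3).
  by rewrite -(soliton_operatorE _ hc b0) add_lfunE opp_lfunE scale_lfunE id_lfunE.
move=> X Y; rewrite !DE !bracketE b0.
by apply: frame_ext; rewrite !(form_vec, linearDl) /= ?form_vec; ring.
Qed.

End Frame.

Theorem theorem2p6 (R : realType) (alpha beta : R) (halpha : alpha != 0)
  (L : vectType R) (br : {bilinear L -> L -> L}) (hbr : is_lie_bracket br)
  (e1 e2 e3 : L) (he : basis_of fullv [:: e1; e2; e3])
  (h12 : br e1 e2 = alpha *: e1 - beta *: e3)
  (h13 : br e1 e3 = - (alpha *: e1) - beta *: e2)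
  (h23 : br e2 e3 = beta *: e1 + alpha *: e2 + alpha *: e3)
  (g : {symmetric L}) (hg : pseudo_orthonormal g e1 e2 e3)
  (J : 'End(L)) (hJ : product_structure J e1 e2 e3)
  (nabla : {bilinear L -> L -> L}) (hnabla : is_levi_civita br g nabla)
  (Ric0 : 'End(L))
  (hRic0 : is_ricci_operator g
     (ricci_tensor br g e1 e2 e3 (canonical_connection nabla J)) Ric0)
  (c : R) :
  (first_kind_algebraic_ricci_soliton br Ric0 c <->
     [/\ alpha ^+ 2 + c = 0, beta = 0 & alpha != 0]) /\
  ([/\ alpha ^+ 2 + c = 0, beta = 0 & alpha != 0] ->
     [/\ Ric0 e1 = - (alpha ^+ 2 *: e1),
         Ric0 e2 = - (alpha ^+ 2 *: e2) &
         Ric0 e3 = alpha ^+ 2 *: e2] /\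
     forall D : 'End(L), soliton_derivation br Ric0 c D ->
       [/\ D e1 = 0, D e2 = 0 &
           D e3 = alpha ^+ 2 *: e2 + alpha ^+ 2 *: e3]).
Proof.
have RE := ricci_frame he hg hbr h12 h13 h23 hJ hnabla hRic0.
have opE := soliton_operatorE he hg hbr h12 h13 h23 hJ hnabla hRic0.
split; [split|].
- move=> [D sD].
  by have [] := soliton_conditions he hg hbr h12 h13 h23 hJ hnabla hRic0 halpha sD.
- move=> [hc b0 _].
  exact: (soliton_exists he hg hbr h12 h13 h23 hJ hnabla hRic0 hc b0).
move=> [hc b0 _]; split.
  have [-> -> ->] := RE; rewrite b0 expr0n /= !mulr0 addr0.
  by rewrite !vec_sum !scale0r !scaleNr !addr0 !add0r.
(* The soliton equation forces D = Ric0 - c Id, so its values on the frame are determined. *)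
move=> D sD; rewrite !(soliton_derivationE _ sD) !(opE _ _ hc b0).
rewrite !(form_frame hg) !mulr0 mulrN1 opprK.
by rewrite !vec_sum !scale0r !addr0 add0r.
Qed.
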